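(* Let $\mathscr{H}$ be a complex Hilbert space, let $k,n$ be positive integers, and let $T$ be a bounded linear operator on $\mathscr{H}$ which is $k$-quasi $n$-power posinormal and such that the range of $T^k$ is not dense in $\mathscr{H}$. Then, with respect to the orthogonal decomposition $\mathscr{H}=\overline{T^k(\mathscr{H})}\oplus \ker(T^{*k})$, $T$ has the matrix form $$T=\begin{pmatrix} A & B\\ 0 & C\end{pmatrix},$$ where $A$ is an $n$-power posinormal operator on $\overline{T^k(\mathscr{H})}$ and $C$ is a nilpotent operator of order $k$ on $\ker(T^{*k})$ (that is, $C^k=0$). Moreover, $\sigma(T)=\sigma(A)\cup\{0\}$.
   Context: For a bounded operator $X$, $R(X)$ denotes its range and $\sigma(X)$ its spectrum; $X^{*k}=(X^* )^k$. A bounded operator $T$ on a Hilbert space is $k$-quasi $n$-power posinormal if $R(T^{*k}T^n)\subseteq R(T^{*(k+1)})$; equivalently, there is $\lambda>0$ with $T^{*k}(\lambda^2T^*T-T^nT^{*n})T^k\ge 0$. A bounded operator $A$ is $n$-power posinormal if there is a positive operator $P\ge 0$ with $A^nA^{*n}=A^*PA$; equivalently, there is $\lambda>0$ with $A^nA^{*n}\le\lambda^2A^*A$. *)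

(* Defs.v *)
From HB Require Import structures.
From mathcomp Require Import all_boot all_order all_algebra.
From mathcomp Require Import sesquilinear complex ring lra.
From mathcomp Require Import boolp classical_sets functions reals filter.
From mathcomp Require Import topology normedtype.
Set Implicit Arguments.
Unset Strict Implicit.
Unset Printing Implicit Defensive.
Import Order.TTheory GRing.Theory Num.Theory.
Import numFieldNormedType.Exports.
Local Open Scope classical_set_scope.
Local Open Scope ring_scope.
Local Open Scope complex_scope.

(* The inner product is linear in its first argument and conjugate-linear in  *)
(* the second; the trivial space is allowed.                                  *)
HB.mixin Record CompleteNormedModule_isHilbert (R : realType) H
    of CompleteNormedModule R[i] H := {
  hdot : {dot H for (@Num.conj R[i])} ;
  hdot_norm : forall x : H, hdot x x = `|x| ^+ 2
}.

#[short(type="hilbertType")]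
HB.structure Definition Hilbert (R : realType) :=
  {H of CompleteNormedModule_isHilbert R H & CompleteNormedModule R[i] H}.

Notation "''[' x , y ]" := (hdot x y) (format "''[' x ,  y ]") : ring_scope.

(* A linear map between normed spaces is bounded iff it is continuous
   (linear_bounded_continuous). *)
#[short(type="boundedOperator")]
HB.structure Definition BoundedOperator (R : numFieldType)
    (H K : normedModType R) :=
  {f of @GRing.Linear R H K *:%R f & @isContinuous H K f}.

Notation "{ 'bounded' H -> K }" := (boundedOperator H K)
  (H at level 98, K at level 99, format "{ 'bounded'  H  ->  K }").

Section HilbertTheory.
Context (R : realType) (H : hilbertType R).
Implicit Types (x y z w : H) (a : R[i]).

Lemma hdotDl x y z : '[x + y, z] = '[x, z] + '[y, z].
Proof. exact: linearDl. Qed.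
Lemma hdotDr x y z : '[x, y + z] = '[x, y] + '[x, z].
Proof. by rewrite linearDr. Qed.
Lemma hdotBl x y z : '[x - y, z] = '[x, z] - '[y, z].
Proof. exact: linearBl. Qed.
Lemma hdotBr x y z : '[x, y - z] = '[x, y] - '[x, z].
Proof. by rewrite linearBr. Qed.
Lemma hdotZl a x y : '[a *: x, y] = a * '[x, y].
Proof. by rewrite linearZl_LR. Qed.
Lemma hdotZr a x y : '[x, a *: y] = (a^*)%R * '[x, y].
Proof. by rewrite linearZr_LR. Qed.
Lemma hdotC x y : '[x, y] = ('[y, x]^*)%R.
Proof. by rewrite hermC expr0 mul1r. Qed.
Lemma hdot0l y : '[0, y] = 0.
Proof. exact: linear0l. Qed.
Lemma hdot0r x : '[x, 0] = 0.
Proof. exact: linear0r. Qed.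

Lemma hdot_eq0 x : '[x, x] = 0 -> x = 0.
Proof. by rewrite hdot_norm => /eqP; rewrite sqrf_eq0 normr_eq0 => /eqP. Qed.

Lemma hdot_inj x y : (forall z, '[z, x] = '[z, y]) -> x = y.
Proof.
move=> h; apply/eqP; rewrite -subr_eq0; apply/eqP/hdot_eq0.
by rewrite hdotBr h subrr.
Qed.

Definition hsq x : R := complex.Re '[x, x].

Lemma hsqE x : '[x, x] = (hsq x)%:C.
Proof. by rewrite /hsq RRe_real// hdot_norm realE exprn_ge0. Qed.

Lemma hsq_ge0 x : 0 <= hsq x.
Proof. by rewrite -ler0c -hsqE hdot_norm exprn_ge0. Qed.

Lemma hsqN x : hsq (- x) = hsq x.
Proof. by apply/complexI; rewrite -!hsqE !hdot_norm normrN. Qed.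

Lemma hsq_norm_lt x (r : R) : 0 < r -> (`|x| < r%:C) = (hsq x < r ^+ 2).
Proof.
move=> r0; rewrite -ltcR -hsqE hdot_norm rmorphXn/= ltr_pXn2r//.
  by rewrite nnegrE.
by rewrite nnegrE ler0c ltW.
Qed.

Lemma hsq_parallelogram x y : hsq (x + y) + hsq (x - y) = 2 * hsq x + 2 * hsq y.
Proof.
rewrite /hsq !hdotBl !hdotBr !hdotDl !hdotDr.
move: '[x, x] '[x, y] '[y, x] '[y, y] => [? ?] [? ?] [? ?] [? ?] /=; ring.
Qed.

Lemma normC_sqE a : `|a| ^+ 2 = (complex.Re (`|a| ^+ 2))%:C.
Proof. by rewrite RRe_real// ger0_real// exprn_ge0. Qed.

Lemma hsqZ a x : hsq (a *: x) = complex.Re (`|a| ^+ 2) * hsq x.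
Proof.
apply/complexI; rewrite -hsqE hdotZl hdotZr mulrA -normCK hsqE.
by rewrite {1}normC_sqE -rmorphM.
Qed.

Lemma hdot_sub_proj x w : w != 0 ->
  '[x - ('[x, w] / '[w, w]) *: w, x - ('[x, w] / '[w, w]) *: w] =
  '[x, x] - `|'[x, w]| ^+ 2 / '[w, w].
Proof.
move=> w0; have s0 : '[w, w] != 0.
  by apply: contra w0 => /eqP/hdot_eq0 ->.
rewrite !hdotBl !hdotBr !hdotZl !hdotZr normCK (hdotC w x) fmorph_div.
rewrite /= -(hdotC w w).
by field.
Qed.

Lemma cauchy_schwarz_sq x w : `|'[x, w]| ^+ 2 <= '[x, x] * '[w, w].
Proof.
have [->|w0] := eqVneq w 0; first by rewrite !hdot0r normr0 mulr0 expr0n.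
have : 0 <= '[x, x] - `|'[x, w]| ^+ 2 / '[w, w].
  by rewrite -hdot_sub_proj// hdot_norm exprn_ge0.
by rewrite subr_ge0 ler_pdivrMr// hdot_norm exprn_gt0// normr_gt0.
Qed.

Lemma cauchy_schwarz x w : `|'[x, w]| <= `|x| * `|w|.
Proof.
rewrite -(@ler_pXn2r _ 2)// ?nnegrE ?mulr_ge0// exprMn -!hdot_norm.
exact: cauchy_schwarz_sq.
Qed.

Lemma closed_orth (y : H) : closed [set x : H | '[x, y] = 0].
Proof.
move=> x cx /=; apply/eqP/negPn/negP => xy0.
have y0 : 0 < `|y|.
  by rewrite normr_gt0; apply: contraNneq xy0 => ->; rewrite hdot0r.
have e0 : 0 < `|'[x, y]| / `|y| by rewrite divr_gt0// normr_gt0.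
have [z [/= zy]] := cx _ (nbhsx_ballx x _ e0).
rewrite -ball_normE/= ltr_pdivlMr// => /(le_lt_trans (cauchy_schwarz _ _)).
by rewrite hdotBl zy subr0 ltxx.
Qed.

End HilbertTheory.

Record closedSubspace (R : realType) (H : hilbertType R) := ClosedSubspace {
  csub_set : set H ;
  csub_closed : closed csub_set ;
  csub0 : csub_set 0 ;
  csubP : forall (a : R[i]) x y,
    csub_set x -> csub_set y -> csub_set (a *: x + y)
}.
Section Projection.
Context (R : realType) (H : hilbertType R) (M : closedSubspace H).
Implicit Types (x y z w m : H) (a : R[i]).

Lemma csubZ a x : csub_set M x -> csub_set M (a *: x).
Proof. by move=> Mx; rewrite -[_ *: _]addr0; apply: csubP => //; exact: csub0. Qed.

Lemma csubD x y : csub_set M x -> csub_set M y -> csub_set M (x + y).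
Proof. by move=> Mx My; rewrite -[x]scale1r; exact: csubP. Qed.

Section Minimizer.
Variable x : H.

Let E : set R := [set hsq (x - m) | m in csub_set M].
Let d := inf E.
Let S (e : R) : set H := [set m | csub_set M m /\ hsq (x - m) < d + e].

Let E_inf : has_inf E.
Proof.
split; first by exists (hsq (x - 0)), 0 => //; exact: csub0.
by exists 0 => _ [m _ <-]; exact: hsq_ge0.
Qed.

Let d_le m : csub_set M m -> d <= hsq (x - m).
Proof. by move=> Mm; apply: ge_inf; [case: E_inf | exists m]. Qed.

Let S_neq0 (e : R) : 0 < e -> S e !=set0.
Proof. by move=> /inf_adherent/(_ E_inf)[_ [m Mm <-] me]; exists m. Qed.

Let S_dist (e : R) m m' : S e m -> S e m' -> hsq (m - m') < 4 * e.
Proof.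
move=> [Mm me] [Mm' me'].
have := hsq_parallelogram (x - m') (x - m).
have -> : x - m' - (x - m) = m - m'.
  by rewrite opprB addrCA addrAC subrr add0r addrC.
have -> : x - m' + (x - m) = 2 *: (x - (2^-1 : R[i]) *: (m + m')).
  rewrite scalerBr scalerA divff ?pnatr_eq0// scale1r scaler_nat mulr2n.
  by rewrite opprD addrACA [- m' + _]addrC.
rewrite hsqZ (_ : complex.Re _ = 4); last first.
  by rewrite normr_nat -natrX -(rmorph_nat (real_complex R)).
have := d_le (csubZ 2^-1 (csubD Mm Mm')).
by lra.
Qed.

Let F := filter_from [set e : R | 0 < e] S.

Let F_proper : ProperFilter F.
Proof.
apply: filter_from_proper; last by move=> e; exact: S_neq0.
apply: filter_from_filter; first by exists 1 => /=.
move=> e e' /= e0 e'0; exists (Num.min e e'); first by rewrite /= lt_min e0.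
move=> m [Mm]; rewrite /S /= => h; split; split => //.
  by apply: (lt_le_trans h); rewrite lerD2l ge_min lexx.
by apply: (lt_le_trans h); rewrite lerD2l ge_min lexx orbT.
Qed.

Let F_cauchy : cauchy F.
Proof.
have FF : Filter F by exact: (@filter_filter _ _ F_proper).
apply/(@cauchy_ballP _ H F FF) => e e0.
have [r er] : exists r : R, e = r%:C by apply/complex_realP/gtr0_real.
have r0 : 0 < r by rewrite -ltcR -er.
have r4 : 0 < r ^+ 2 / 4 by rewrite divr_gt0 ?exprn_gt0.
exists (S (r ^+ 2 / 4), S (r ^+ 2 / 4)); first by split; exists (r ^+ 2 / 4).
move=> [m m'] [/= Sm Sm']; rewrite -ball_normE/= er hsq_norm_lt//.
by have := S_dist Sm Sm'; lra.
Qed.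

Lemma projection_exists : exists m, csub_set M m /\ forall w, csub_set M w -> '[x - m, w] = 0.
Proof.
have /cvg_ex[m Fm] : cvg F by exact: (@cauchy_cvg H F F_proper F_cauchy).
have FmB B : nbhs m B -> F B by move=> /Fm.
exists m; split.
  apply: csub_closed => B /FmB[e /= e0 SB].
  by have [m' Sm'] := S_neq0 e0; exists m'; split; [case: Sm'|exact: SB].
have approx (e : R) : 0 < e -> exists m', S e m' /\ hsq (m - m') < e.
  move=> e0; have s0 : 0 < Num.sqrt e by rewrite sqrtr_gt0.
  have /FmB[e' /= e'0 SB] : nbhs m (ball m (Num.sqrt e)%:C).
    by apply: nbhsx_ballx; rewrite ltcR.
  have m0 : 0 < Num.min e e' by rewrite lt_min e0.
  have [m' [Mm' m'e]] := S_neq0 m0.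
  exists m'; split; first by split=> //; apply: lt_le_trans m'e _; rewrite lerD2l ge_min lexx.
  have /SB : S e' m'.
    by split=> //; apply: lt_le_trans m'e _; rewrite lerD2l ge_min lexx orbT.
  by rewrite -ball_normE/= hsq_norm_lt// sqr_sqrtr// ltW.
move=> w Mw; have [->|w0] := eqVneq w 0; first exact: hdot0r.
have qw0 : 0 < hsq w.
  by rewrite -ltcR -hsqE hdot_norm exprn_gt0// normr_gt0.
pose s (z : R[i]) : R := complex.Re z ^+ 2 + complex.Im z ^+ 2.
have sE (c : R[i]) : `|c| ^+ 2 = (s c)%:C by rewrite -add_Re2_Im2.
suff s0 : s '[x - m, w] = 0.
  by apply/eqP; rewrite -normr_eq0 -sqrf_eq0 sE s0.
have sge0 : 0 <= s '[x - m, w] by rewrite addr_ge0 ?sqr_ge0.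
have bound (e : R) : 0 < e -> s '[x - m, w] <= 4 * e * hsq w.
  move=> /approx[m' [[Mm' m'e] mm'e]].
  have h1 : s '[x - m', w] <= e * hsq w.
    have /d_le : csub_set M (m' + ('[x - m', w] / '[w, w]) *: w).
      by apply: csubD => //; exact: csubZ.
    rewrite -lecR opprD addrA -hsqE hdot_sub_proj// sE !hsqE -fmorph_div -rmorphB/=.
    rewrite lecR lerBrDr -lerBrDl => h.
    rewrite -ler_pdivrMr//; apply: (le_trans h).
    by rewrite lerBlDl ltW.
  have h2 : s '[m' - m, w] <= e * hsq w.
    have := cauchy_schwarz_sq (m' - m) w; rewrite sE !hsqE -rmorphM/= lecR.
    move=> /le_trans; apply; rewrite ler_wpM2r ?hsq_ge0//.
    by rewrite -hsqN opprB ltW.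
  have -> : x - m = (x - m') + (m' - m) by rewrite addrA subrK.
  rewrite hdotDl -mulrA; move: (e * hsq w) h1 h2 => t; rewrite /s.
  move: '[x - m', w] '[m' - m, w] => [a b] [a' b'] /=.
  by move: (sqr_ge0 (a - a')) (sqr_ge0 (b - b')); rewrite !sqrrB !sqrrD; lra.
apply/eqP; rewrite eq_le sge0 andbT leNgt; apply/negP => spos.
have e0 : 0 < s '[x - m, w] / (8 * hsq w) by rewrite divr_gt0// mulr_gt0.
have := bound _ e0.
rewrite (_ : 4 * _ * _ = s '[x - m, w] / 2); first by lra.
by field; rewrite gt_eqF.
Qed.

End Minimizer.
End Projection.

Section Adjoint.
Context (R : realType) (H K : hilbertType R) (T : {bounded H -> K}).

Lemma riesz (y : K) : exists x : H, forall z, '[T z, y] = '[z, x].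
Proof.
have N_closed : closed [set z | '[T z, y] = 0].
  apply: (@preimage_closed H K T [set v | '[v, y] = 0]); last exact: closed_orth.
  by move=> x _; exact: cts_fun.
have N0 : [set z | '[T z, y] = 0] 0 by rewrite /= linear0 hdot0l.
have NP (a : R[i]) u v : [set z | '[T z, y] = 0] u -> [set z | '[T z, y] = 0] v ->
    [set z | '[T z, y] = 0] (a *: u + v).
  by rewrite /= linearP hdotDl hdotZl => -> ->; rewrite mulr0 addr0.
pose N := ClosedSubspace N_closed N0 NP.
have [[x0 Tx0]|Ty0] := pselect (exists x0, '[T x0, y] != 0); last first.
  exists 0 => z; rewrite hdot0r; apply/eqP/negPn/negP => Tz.
  by apply: Ty0; exists z.
have [m [/= Nm orth]] := projection_exists N x0.
pose u := x0 - m.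
have Tu : '[T u, y] != 0 by rewrite linearB hdotBl Nm subr0.
have u0 : '[u, u] != 0.
  by apply: contra Tu => /eqP/hdot_eq0 ->; rewrite linear0 hdot0l.
exists (('[T u, y] / '[u, u])^*%R *: u) => z.
have Nz : '[T (z - ('[T z, y] / '[T u, y]) *: u), y] = 0.
  by rewrite linearB linearZ hdotBl hdotZl divfK// subrr.
have := orth _ Nz; rewrite -/u hdotBr hdotZr => /eqP; rewrite subr_eq0 => /eqP uz.
rewrite hdotZr conjCK (hdotC z) uz rmorphM/= conjCK -(hdotC u u).
by field; rewrite Tu u0.
Qed.

(* The operator T^* : it exists and is unique by the Riesz representation     *)
(* theorem.                                                                   *)
Definition adjoint (y : K) : H := xget 0 [set x | forall z, '[T z, y] = '[z, x]].

Lemma adjointP x y : '[T x, y] = '[x, adjoint y].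
Proof. by rewrite /adjoint; case: xgetP => [z _ ->//|]; have [z zP /(_ z)] := riesz y. Qed.

Fact adjoint_is_linear : linear adjoint.
Proof.
move=> a x y; apply: hdot_inj => z.
by rewrite -adjointP hdotDr hdotZr !adjointP -hdotZr -hdotDr.
Qed.

HB.instance Definition _ :=
  GRing.isLinear.Build R[i] K H *:%R adjoint adjoint_is_linear.

Fact adjoint_continuous : continuous adjoint.
Proof.
apply/linear_bounded_continuous/linear_boundedP.
have : bounded_near T (nbhs 0) by apply/linear_bounded_continuous; exact: cts_fun.
move=> /linear_boundedP/pinfty_ex_gt0[M M0 TM].
near=> r; move=> x /=.
have M_r : M <= r by near: r; apply: nbhs_pinfty_ge; exact: gtr0_real.
apply: (@le_trans _ _ (M * `|x|)); last by rewrite ler_wpM2r.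
have [->|a0] := eqVneq (adjoint x) 0; first by rewrite normr0 mulr_ge0// ltW.
rewrite -(@ler_pM2r _ `|adjoint x|) ?normr_gt0// -expr2 -hdot_norm -adjointP.
rewrite -[leLHS]ger0_norm; last by rewrite adjointP hdot_norm exprn_ge0.
apply: (le_trans (cauchy_schwarz _ _)).
by rewrite [leRHS]mulrAC ler_wpM2r// TM.
Unshelve. all: by end_near. Qed.

HB.instance Definition _ := isContinuous.Build K H adjoint adjoint_continuous.

End Adjoint.

Section Iter.
Context (R : numFieldType) (H : normedModType R) (T : {bounded H -> H}) (k : nat).

Fact iter_is_linear : linear (iter k T).
Proof. by move=> a x y; elim: k => //= n ->; rewrite linearP. Qed.

HB.instance Definition _ :=
  GRing.isLinear.Build R H H *:%R (iter k T) iter_is_linear.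

Fact iter_continuous : continuous (iter k T).
Proof.
elim: k => [|n IH] x /=; first exact: cvg_id.
by apply: (@continuous_comp _ _ _ (iter n T) T); [exact: IH|exact: cts_fun].
Qed.

HB.instance Definition _ := isContinuous.Build H H (iter k T) iter_continuous.

End Iter.

Section Subspaces.
Context (R : realType) (H K : hilbertType R) (T : {bounded H -> K}).

Fact closure_range0 : closure (range T) 0.
Proof. by apply: subset_closure; exists 0 => //; rewrite linear0. Qed.

Fact closure_rangeP (a : R[i]) x y : closure (range T) x ->
  closure (range T) y -> closure (range T) (a *: x + y).
Proof.
move=> cx cy B /nbhs_ballP[e /= e0 eB].
pose e1 := e / 2 / (1 + `|a|).
have a0 : 0 < 1 + `|a| by rewrite ltr_pwDl.
have e10 : 0 < e1 by rewrite !divr_gt0.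
have e20 : 0 < e / 2 by rewrite divr_gt0.
have [_ [[u _ <-] xu]] := cx _ (nbhsx_ballx x _ e10).
have [_ [[v _ <-] yv]] := cy _ (nbhsx_ballx y _ e20).
exists (T (a *: u + v)); split; first by exists (a *: u + v).
apply: eB; move: xu yv; rewrite -ball_normE/= linearP => xu yv.
rewrite opprD addrACA -scalerBr (le_lt_trans (ler_normD _ _))// (splitr e).
rewrite normrZ ler_ltD// (@le_trans _ _ ((1 + `|a|) * e1))//.
  by rewrite ler_pM ?lerDr// ltW.
by rewrite /e1 mulrC divfK// gt_eqF.
Qed.

Definition op_closure_range : closedSubspace K :=
  ClosedSubspace (@closed_closure _ (range T)) closure_range0 closure_rangeP.

Fact kernel_closed : closed [set x | T x = 0].
Proof.
apply: (@preimage_closed H K T [set 0]); first by move=> x _; exact: cts_fun.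
exact/accessible_closed_set1/hausdorff_accessible/norm_hausdorff.
Qed.

Fact kernelP (a : R[i]) x y : [set x | T x = 0] x -> [set x | T x = 0] y ->
  [set x | T x = 0] (a *: x + y).
Proof. by move=> /= Tx Ty; rewrite linearP/= Tx Ty scaler0 addr0. Qed.

Definition op_kernel : closedSubspace H :=
  ClosedSubspace kernel_closed (linear0 T) kernelP.

End Subspaces.

Section SubspaceHilbert.
Context (R : realType) (H : hilbertType R) (M : closedSubspace H).

Definition csub_pred : {pred H} := fun x => `[< csub_set M x >].

Fact csub_submod_closed : submod_closed csub_pred.
Proof.
split; first by apply/asboolP; exact: csub0.
by move=> a x y /asboolP Mx /asboolP My; apply/asboolP; exact: csubP.
Qed.

HB.instance Definition _ :=
  GRing.isSubmodClosed.Build R[i] H csub_pred csub_submod_closed.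

Record hsubspace : Type := HSubspace {
  hsubspace_val :> H ;
  _ : hsubspace_val \in csub_pred
}.

HB.instance Definition _ := [isSub for hsubspace_val].
HB.instance Definition _ := [Choice of hsubspace by <:].
HB.instance Definition _ := [SubChoice_isSubLmodule of hsubspace by <:].

Let hsubspace_norm (u : hsubspace) : R[i] := `|val u|.

Fact hsubspace_ler_normD u v :
  hsubspace_norm (u + v) <= hsubspace_norm u + hsubspace_norm v.
Proof. exact: ler_normD. Qed.

Fact hsubspace_normrZ (a : R[i]) u :
  hsubspace_norm (a *: u) = `|a| * hsubspace_norm u.
Proof. exact: normrZ. Qed.

Fact hsubspace_normr0_eq0 u : hsubspace_norm u = 0 -> u = 0.
Proof. by move/normr0_eq0 => u0; apply: val_inj. Qed.

HB.instance Definition _ := Lmodule_isNormed.Build R[i] hsubspace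
  hsubspace_ler_normD hsubspace_normrZ hsubspace_normr0_eq0.

Fact hsubspace_complete (F : set_system hsubspace) :
  ProperFilter F -> cauchy F -> cvg F.
Proof.
move=> FF F_cauchy.
have cF : cvg (hsubspace_val @ F).
  apply/cauchy_cvgP/cauchy_ballP => e e0.
  have [[A B] /= [FA FB] AB] := (cauchy_ballP F).2 F_cauchy e e0.
  exists (hsubspace_val @` A, hsubspace_val @` B) => /=.
    split; rewrite nbhs_filterE /=.
      by apply: filterS FA => u Au; exists u.
    by apply: filterS FB => u Bu; exists u.
  move=> [_ _] [/= [u Au <-] [v Bv <-]].
  by have := AB (u, v) (conj Au Bv); rewrite -!ball_normE.
have /cvg_ex[x Fx] := cF.
have Mx : x \in csub_pred.
  apply/asboolP/csub_closed => B /Fx /=.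
  rewrite nbhs_filterE => /(filter_ex (F := F))[u Bu].
  by exists (val u); split => //; apply/asboolP/(valP u).
apply/cvg_ex; exists (HSubspace Mx).
apply/cvgrPdist_lt => e e0.
move/cvgrPdist_lt : Fx => /(_ e e0).
by apply: filterS.
Qed.

HB.instance Definition _ := Uniform_isComplete.Build hsubspace hsubspace_complete.

Definition hsubspace_dot (u v : hsubspace) : R[i] := '[val u, val v].

Fact hsubspace_dot_bilinear :
  bilinear_for *%R (Num.conj \; *%R) hsubspace_dot.
Proof.
split=> u a v w; rewrite /hsubspace_dot.
  by rewrite -[val (a *: v + w)]/(a *: val v + val w) hdotDl hdotZl.
by rewrite -[val (a *: v + w)]/(a *: val v + val w) hdotDr hdotZr.
Qed.

HB.instance Definition _ := bilinear_isBilinear.Build R[i] hsubspace hsubspace R[i]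
  *%R (Num.conj \; *%R) hsubspace_dot hsubspace_dot_bilinear.

Fact hsubspace_dot_hermitian u v :
  hsubspace_dot u v = (-1) ^+ false * Num.conj (hsubspace_dot v u).
Proof. by rewrite expr0 mul1r; exact: hdotC. Qed.

HB.instance Definition _ := isHermitianSesquilinear.Build R[i] hsubspace
  false Num.conj hsubspace_dot hsubspace_dot_hermitian.

Fact hsubspace_dot_gt0 u : u != 0 -> 0 < hsubspace_dot u u.
Proof. by move=> u0; rewrite /hsubspace_dot hdot_norm exprn_gt0// normr_gt0. Qed.

HB.instance Definition _ :=
  isDotProduct.Build R[i] hsubspace hsubspace_dot hsubspace_dot_gt0.

Fact hsubspace_dot_norm (u : hsubspace) : hsubspace_dot u u = `|u| ^+ 2.
Proof. exact: hdot_norm. Qed.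

HB.instance Definition _ :=
  CompleteNormedModule_isHilbert.Build R hsubspace hsubspace_dot_norm.

End SubspaceHilbert.

Section OperatorNotions.
Context (R : realType) (H : hilbertType R).
Implicit Types (T A P S : {bounded H -> H}) (k n : nat) (M N : closedSubspace H).

Definition positive_operator P := forall x : H, 0 <= '[P x, x].

Definition n_power_posinormal n A :=
  exists2 P : {bounded H -> H}, positive_operator P &
    forall x : H, iter n A (iter n (adjoint A) x) = adjoint A (P (A x)).

Definition k_quasi_n_power_posinormal k n T :=
  range (iter k (adjoint T) \o iter n T) `<=` range (iter k.+1 (adjoint T)).

(* On the trivial space every operator is invertible and the spectrum is empty. *)
Definition spectrum T : set R[i] :=
  [set a | ~ exists S : {bounded H -> H},
    (forall x, S (T x - a *: x) = x) /\ (forall x, T (S x) - a *: S x = x)].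

Definition orthogonal_decomposition M N :=
  (forall x y, csub_set M x -> csub_set N y -> '[x, y] = 0) /\
  (forall z, exists x y, [/\ csub_set M x, csub_set N y & z = x + y]).

(* T is the operator matrix [A, B; D, C] with respect to H = M + N. *)
Definition has_matrix_form M N T
    (A : hsubspace M -> hsubspace M) (B : hsubspace N -> hsubspace M)
    (D : hsubspace M -> hsubspace N) (C : hsubspace N -> hsubspace N) :=
  forall (u : hsubspace M) (v : hsubspace N),
    T (val u + val v) = val (A u + B v) + val (D u + C v).

End OperatorNotions.

(* Main.v *)
Require Import Defs.
From HB Require Import structures.
From mathcomp Require Import all_boot all_order all_algebra complex lra.
From mathcomp Require Import boolp classical_sets functions reals filter.
From mathcomp Require Import topology normedtype.
Import Order.TTheory GRing.Theory Num.Theory.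
Import numFieldNormedType.Exports.
Local Open Scope classical_set_scope.
Local Open Scope ring_scope.
Local Open Scope complex_scope.

(* Let i be the inclusion of M, the closure of the range of T^k; then i^* is
   the projection onto M = (ker T^*k)^perp, and A = i^* T i satisfies
   i A^n = T^n i.  If T^*k T^n i u = T^*(k+1) w, then T^n i u - T^* w lies in
   ker T^*k, which is orthogonal to M, so A^n u = A^* i^* w.  Thus the range of
   A^n is contained in that of A^*, and Douglas' lemma gives a bounded D with
   A^n = A^* D; taking adjoints, A^n A^*n = A^* D D^* A.
   For the spectrum, 0 belongs to it because T^k is not onto, and for a <> 0
   the corner C - a is invertible (C is nilpotent), so the triangular matrix
   T - a is invertible exactly when A - a is. *)

(** * Real-valued norms *)

Section RealNorm.
Context {R : realType} {V : normedZmodType R[i]}.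
Implicit Types x y : V.

(** The norm takes values in [R[i]]; its real part moves estimates to the totally ordered field
    [R]. *)
Definition rnorm x : R := complex.Re `|x|.

Lemma rnormE x : `|x| = (rnorm x)%:C.
Proof. by rewrite /rnorm RRe_real// realE normr_ge0. Qed.

Lemma rnorm_ge0 x : 0 <= rnorm x.
Proof. by rewrite -ler0c -rnormE. Qed.

Lemma rnorm_gt0 x : (0 < rnorm x) = (x != 0).
Proof. by rewrite -ltcR -rnormE normr_gt0. Qed.

Lemma rnorm0 : rnorm (0 : V) = 0.
Proof. by rewrite /rnorm normr0. Qed.

Lemma rnormD x y : rnorm (x + y) <= rnorm x + rnorm y.
Proof. by rewrite -lecR rmorphD/= -!rnormE ler_normD. Qed.

Lemma rnormN x : rnorm (- x) = rnorm x.
Proof. by rewrite /rnorm normrN. Qed.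

Lemma rdistC x y : rnorm (x - y) = rnorm (y - x).
Proof. by rewrite /rnorm distrC. Qed.

End RealNorm.

Lemma rnormZ {R : realType} {V : normedModType R[i]} (a : R[i]) (x : V) :
  rnorm (a *: x) = rnorm a * rnorm x.
Proof. by apply: complexI; rewrite rmorphM/= -!rnormE normrZ. Qed.

Lemma rnormM {R : realType} (a b : R[i]) : rnorm (a * b) = rnorm a * rnorm b.
Proof. by apply: complexI; rewrite rmorphM/= -!rnormE normrM. Qed.

Lemma rnorm_real {R : realType} (r : R) : 0 <= r -> rnorm r%:C = r.
Proof. by move=> r0; apply: complexI; rewrite -rnormE ger0_norm// ler0c. Qed.

(** * Constructing bounded operators *)

Section BoundedOperators.
Context {R : realType}.
Implicit Types H K L : normedModType R[i].

Lemma bounded_continuous {H K} (f : {linear H -> K}) (c : R) :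
  (forall x, rnorm (f x) <= c * rnorm x) -> continuous f.
Proof.
move=> fc; apply/linear_bounded_continuous/linear_boundedP.
exists c%:C; split=> [|r cr x].
  by apply/complex_realP; exists c.
apply: (@le_trans _ _ (c%:C * `|x|)).
  by rewrite !rnormE -rmorphM/= lecR.
by rewrite ler_wpM2r// ltW.
Qed.

Definition bounded_op {H K} {f : H -> K} (fl : linear f) (fc : continuous f) :
    {bounded H -> K} :=
  HB.pack f (GRing.isLinear.Build R[i] H K *:%R f fl)
    (isContinuous.Build H K f fc).

(** Linearity is restated for compositions, and below for the identity, so that it joins with
    continuity into the structure of a bounded operator. *)
HB.instance Definition _ H K L (g : {bounded K -> L}) (f : {bounded H -> K}) :=
  GRing.Linear.on (g \o f).
HB.instance Definition _ H := GRing.Linear.on (@idfun H).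

Section BoundedLinear.
Context {H K : normedModType R[i]} (f : {bounded H -> K}).

Lemma bounded0 : f 0 = 0. Proof. exact: linear0. Qed.
Lemma boundedD x y : f (x + y) = f x + f y. Proof. exact: linearD. Qed.
Lemma boundedB x y : f (x - y) = f x - f y. Proof. exact: linearB. Qed.
Lemma boundedZ a x : f (a *: x) = a *: f x. Proof. exact: linearZ_LR. Qed.

End BoundedLinear.

(** Supplies the sums and multiples of operators from which the resolvents below are assembled. *)
Lemma ex_bounded_lincomb {H K} (a b : R[i]) (f g : {bounded H -> K}) :
  exists h : {bounded H -> K}, forall x, h x = a *: f x + b *: g x.
Proof.
have hl : linear (fun x => a *: f x + b *: g x).
  move=> c x y; rewrite (linearP f) (linearP g) !scalerDr !scalerA.
  by rewrite !(mulrC c) addrACA.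
have hc : continuous (fun x => a *: f x + b *: g x).
  by move=> x; apply: cvgD; apply: cvgZr; exact: cts_fun.
by exists (bounded_op hl hc).
Qed.

End BoundedOperators.

(** * Completeness and the uniform boundedness principle *)

Lemma nested_balls_cvg {R : realType} {H : completeNormedModType R[i]}
    (z : nat -> H) (r : nat -> R) :
  (forall e, 0 < e -> exists n, r n < e) ->
  (forall n x, rnorm (x - z n.+1) <= r n.+1 -> rnorm (x - z n) <= r n) ->
  (forall n, 0 <= r n) ->
  exists l, forall n, rnorm (l - z n) <= r n.
Proof.
move=> r_small nest r_ge0.
pose B n : set H := [set x | rnorm (x - z n) <= r n].
have Bz n : B n (z n) by rewrite /B/= subrr /rnorm normr0.
have Bsub m n : (m <= n)%N -> B n `<=` B m.
  elim: n => [|n IH]; first by rewrite leqn0 => /eqP->.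
  rewrite leq_eqVlt => /predU1P[->//|]; rewrite ltnS => /IH mn x Bx.
  exact/mn/nest.
(* The balls are a base of a Cauchy filter; its limit lies in each of them because they are
   closed. *)
pose F := filter_from setT B.
have FF : ProperFilter F.
  apply: filter_from_proper; last by move=> n _; exists (z n).
  apply: filter_from_filter; first by exists 0%N.
  move=> m n _ _; exists (maxn m n) => // x Bx.
  by split; apply: Bsub Bx; rewrite (leq_maxl, leq_maxr).
have F_cauchy : cauchy F.
  apply/cauchy_ballP => e e0.
  have [c ec] : exists c : R, e = c%:C by apply/complex_realP/gtr0_real.
  have c0 : 0 < c by rewrite -ltcR -ec.
  have [n rn] := r_small (c / 2) (divr_gt0 c0 (ltr0Sn _ 1)).
  exists (B n, B n); first by split; exists n.
  move=> [x y] [/= Bx By]; rewrite -ball_normE/= ec rnormE ltcR.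
  have := rnormD (x - z n) (z n - y); rewrite addrA subrK (rdistC (z n)).
  by move: Bx By rn; rewrite /B/=; lra.
have /cvg_ex[l Fl] : cvg F by exact: (@cauchy_cvg H F FF F_cauchy).
exists l => n; apply/ler_addgt0Pr => e e0.
have e0' : 0 < e%:C by rewrite ltcR.
have : F (ball l e%:C) by apply/Fl/nbhsx_ballx.
move=> [m _ BmB].
have Bx : B n (z (maxn m n)) by exact: (Bsub _ _ (leq_maxr m n)).
have /BmB : B m (z (maxn m n)) by exact: (Bsub _ _ (leq_maxl m n)).
rewrite -ball_normE/= rnormE ltcR => lx.
have := rnormD (l - z (maxn m n)) (z (maxn m n) - z n); rewrite addrA subrK.
by move: Bx; rewrite /B/=; lra.
Qed.

Section Hilbert.
Context {R : realType} {H : hilbertType R}.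
Implicit Types (x y z a : H) (S : set H).

Lemma hdot_rnorm x : '[x, x] = (rnorm x ^+ 2)%:C.
Proof. by rewrite hdot_norm rnormE rmorphXn. Qed.

Lemma cauchy_schwarz_rnorm x y : rnorm '[x, y] <= rnorm x * rnorm y.
Proof. by rewrite -lecR rmorphM/= -!rnormE cauchy_schwarz. Qed.

(* One of z and z + (r/2) a/|a| is the centre of the smaller ball. *)
Lemma large_functional_ball z a (r : R) : 0 < r ->
  exists z', forall x, rnorm (x - z') <= r / 8 ->
    rnorm (x - z) <= r /\ r / 8 * rnorm a <= rnorm '[x, a].
Proof.
move=> r0; have [->|a0] := eqVneq a 0.
  exists z => x xz; rewrite hdot0r !rnorm0 mulr0 lexx; split=> //.
  by lra.
have na0 : 0 < rnorm a by rewrite rnorm_gt0.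
pose h := (r / 2 / rnorm a)%:C *: a.
have nh : rnorm h = r / 2.
  by rewrite rnormZ rnorm_real ?divfK ?gt_eqF// !divr_ge0// ltW.
have ha : rnorm '[h, a] = r / 2 * rnorm a.
  rewrite hdotZl rnormM hdot_rnorm !rnorm_real ?sqr_ge0 ?divr_ge0// ?ltW//.
  by rewrite expr2 mulrA divfK// gt_eqF.
(* Moving by [r / 8] from the centre changes the functional by at most [r / 8 * |a|], so a value
   [r / 4 * |a|] at the centre suffices. *)
have near z' x : rnorm (x - z') <= r / 8 -> r / 4 * rnorm a <= rnorm '[z', a] ->
    r / 8 * rnorm a <= rnorm '[x, a].
  move=> xz' z'a; have := rnormD '[z' - x, a] '[x, a].
  rewrite -hdotDl subrK.
  have := cauchy_schwarz_rnorm (z' - x) a; rewrite rdistC.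
  have : rnorm (x - z') * rnorm a <= r / 8 * rnorm a by rewrite ler_pM2r.
  by move: z'a; rewrite [r / 4 * _]mulrAC [r / 8 * _]mulrAC; lra.
have [za|za] := leP (r / 4 * rnorm a) (rnorm '[z, a]).
  exists z => x xz; split; last exact: near xz za.
  by lra.
(* Here the value at [z] is below [r / 4 * |a|] and the value at [h] is [r / 2 * |a|] in modulus, so
   their sum is large enough. *)
exists (z + h) => x xz; split.
  move: (rnormD (x - (z + h)) h) xz; rewrite opprD addrA subrK nh.
  by lra.
apply: near xz _.
have := rnormD '[z + h, a] '[- z, a].
rewrite -hdotDl addrAC subrr add0r ha -scaleN1r hdotZl mulN1r rnormN.
by move: za; rewrite [r / 4 * _]mulrAC [r / 2 * _]mulrAC; lra.
Qed.

(** Uniform boundedness for the functionals ['[_, a]], by nested balls: if [S] were unbounded, some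
    point would lie in balls on which, for each [n], a functional from [S] is at least [n]. *)
Lemma weakly_bounded S :
  (forall x, exists c : R, forall a, S a -> rnorm '[x, a] <= c) ->
  exists c : R, forall a, S a -> rnorm a <= c.
Proof.
move=> wb; apply: contrapT => nb.
have large (c : R) : exists2 a, S a & c < rnorm a.
  apply: contrapT => nS; apply: nb; exists c => a Sa.
  by rewrite leNgt; apply/negP => ca; apply: nS; exists a.
(* Each application of [large_functional_ball] divides the radius by 8. *)
pose r n : R := 8 ^- n.
have r0 n : 0 < r n by rewrite invr_gt0 exprn_gt0.
have rS n : r n / 8 = r n.+1 by rewrite /r exprSr invfM.
have step (p : nat * H) : exists z', forall x, rnorm (x - z') <= r p.1.+1 ->
    rnorm (x - p.2) <= r p.1 /\ exists2 a, S a & p.1%:R <= rnorm '[x, a].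
  (* A vector this long makes the lower bound [r n / 8 * |a|] at least [n]. *)
  have [a Sa an] := large (p.1%:R / r p.1.+1).
  have [z' z'P] := large_functional_ball p.2 a _ (r0 p.1).
  exists z' => x; rewrite -rS => /z'P[xz xa]; split=> //; exists a => //.
  apply: le_trans xa; rewrite rS mulrC -ler_pdivrMr//; exact: ltW.
have [f fP] := choice step.
pose z := fix z n := if n is m.+1 then f (m, z m) else 0.
have zP n x : rnorm (x - z n.+1) <= r n.+1 ->
  rnorm (x - z n) <= r n /\ exists2 a, S a & n%:R <= rnorm '[x, a] := fP (n, z n) x.
have [l lz] : exists l, forall n, rnorm (l - z n) <= r n.
  apply: nested_balls_cvg => [e e0|n x /zP[]//|n]; last exact: ltW.
  exists (Num.truncn e^-1).+1.
  rewrite /r -[ltRHS]invrK ltf_pV2 ?posrE ?invr_gt0// ?exprn_gt0//.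
  apply: (lt_trans (truncnS_gt _)).
  by rewrite -natrX ltr_nat ltn_expl.
have [c cP] := wb l.
have [_ [a Sa]] := zP (Num.truncn c).+1 l (lz _).
by rewrite leNgt (le_lt_trans (cP a Sa))// truncnS_gt.
Qed.

End Hilbert.

(** * Adjoints, orthogonality and projection onto a closed subspace *)

Lemma adjointPr {R : realType} {H K : hilbertType R} (T : {bounded H -> K}) x y :
  '[adjoint T y, x] = '[y, T x].
Proof. by rewrite hdotC -adjointP -hdotC. Qed.

Lemma iter_adjointP {R : realType} {H : hilbertType R} (T : {bounded H -> H}) n x y :
  '[iter n T x, y] = '[x, iter n (adjoint T) y].
Proof. by elim: n x => // n IH x; rewrite iterSr IH adjointP. Qed.

Lemma hdot_eq0_sym {R : realType} {H : hilbertType R} (x y : H) :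
  '[x, y] = 0 -> '[y, x] = 0.
Proof. by move=> xy0; rewrite hdotC xy0 rmorph0. Qed.

Lemma orth_closure {R : realType} {H : hilbertType R} (S : set H) (y : H) :
  (forall x, S x -> '[x, y] = 0) -> forall x, closure S x -> '[x, y] = 0.
Proof.
move=> Sy x /(closure_subset (B := [set x | '[x, y] = 0]) Sy).
by rewrite -(closure_id _).1//; exact: closed_orth.
Qed.

Section Inclusion.
Context {R : realType} {H : hilbertType R}.

(** A separate name, so that the inclusion can carry the structure of a bounded operator and have an
    adjoint. *)
Definition hincl {M : closedSubspace H} : hsubspace M -> H := \val.

Context {M : closedSubspace H}.
Implicit Types (u v : hsubspace M) (x y : H).

Fact hincl_linear : linear (@hincl M).
Proof. by []. Qed.

HB.instance Definition _ :=
  GRing.isLinear.Build R[i] (hsubspace M) H *:%R (@hincl M) hincl_linear.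

Fact hincl_continuous : continuous (@hincl M).
Proof. by apply: (bounded_continuous _ 1) => u; rewrite mul1r. Qed.

HB.instance Definition _ :=
  isContinuous.Build (hsubspace M) H (@hincl M) hincl_continuous.

Definition hproj : {bounded H -> hsubspace M} := adjoint (@hincl M).

Lemma hdot_hincl u v : '[hincl u, hincl v] = '[u, v].
Proof. by []. Qed.

Lemma hinclP u : csub_set M (hincl u).
Proof. exact/asboolP/(valP u). Qed.

Lemma hincl_ex x : csub_set M x -> exists u : hsubspace M, hincl u = x.
Proof. by move=> /asboolP Mx; exists (HSubspace Mx). Qed.

Lemma hprojP u x : '[hincl u, x] = '[u, hproj x].
Proof. exact: adjointP. Qed.

Lemma hprojK u : hproj (hincl u) = u.
Proof. by apply: hdot_inj => v; rewrite -hprojP hdot_hincl. Qed.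

Lemma hproj_orth x w : csub_set M w -> '[w, x - hincl (hproj x)] = 0.
Proof.
by move=> /hincl_ex[u <-]; rewrite hdotBr hprojP hdot_hincl subrr.
Qed.

Lemma hproj_eq0 x : (forall w, csub_set M w -> '[w, x] = 0) -> hproj x = 0.
Proof.
by move=> Mx; apply: hdot_inj => u; rewrite -hprojP hdot0r Mx//; exact: hinclP.
Qed.

End Inclusion.

(** * Range inclusion and factorization *)

Section RangeInclusion.
Context {R : realType} {H K L : hilbertType R}.
Variables (X : {bounded H -> L}) (Y : {bounded K -> L}).
Hypothesis XY : range X `<=` range Y.

Let M := op_closure_range (adjoint Y).

(** Any solution [w] may be projected onto [M]: the remainder is orthogonal to the range of [Y^*],
    hence lies in the kernel of [Y]. *)
Let lift_ex z : exists u : hsubspace M, Y (hincl u) = X z.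
Proof.
have [|w _ Yw] := XY (X z); first by exists z.
exists (hproj w); rewrite -Yw; apply/esym/eqP.
rewrite -subr_eq0 -linearB; apply/eqP/hdot_inj => t.
rewrite hdot0r -adjointPr; apply: hproj_orth.
by apply: subset_closure; exists t.
Qed.

(** The difference lies both in [M] and in the kernel of [Y], which is orthogonal to [M]. *)
Let factor_inj (u v : hsubspace M) : Y (hincl u) = Y (hincl v) -> u = v.
Proof.
move=> /eqP; rewrite -subr_eq0 -!linearB => /eqP Yuv.
apply/eqP; rewrite -subr_eq0; apply/eqP/hdot_eq0; rewrite -hdot_hincl.
apply: (orth_closure (range (adjoint Y)) _ _ _ (hinclP (u - v))) => _ [t _ <-].
by rewrite adjointPr Yuv hdot0r.
Qed.

(* Douglas' lemma. The solution [D z] of [Y (D z) = X z] in the closure of the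
   range of [Y^*] is unique, and it is bounded because the vectors
   [X^* t / |Y^* t|] form a weakly bounded set. *)
Lemma range_factorization : exists D : {bounded H -> K}, forall z, X z = Y (D z).
Proof.
have [f fP] := choice lift_ex.
have fl : linear f.
  move=> a x y; apply: factor_inj.
  rewrite fP (_ : X _ = a *: X x + X y); last exact: linearP.
  by rewrite -!fP; exact/esym/(linearP Y).
have hXY z t : '[hincl (f z), adjoint Y t] = '[z, adjoint X t].
  by rewrite -!adjointP fP.
(* When [Y^* t = 0] the inverse is 0 by convention, and the vector is 0. *)
pose S : set H := range (fun t => (rnorm (adjoint Y t))^-1%:C *: adjoint X t).
have [c cS] : exists c : R, forall a, S a -> rnorm a <= c.
  apply: weakly_bounded => z; exists (rnorm (f z)) => _ [t _ <-].
  rewrite hdotZr -hXY rnormM {1}/rnorm norm_conjC -/(rnorm _).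
  rewrite rnorm_real ?invr_ge0 ?rnorm_ge0// mulrC.
  have [->|Yt0] := eqVneq (adjoint Y t) 0.
    by rewrite rnorm0 invr0 mulr0 rnorm_ge0.
  by rewrite ler_pdivrMr ?rnorm_gt0// cauchy_schwarz_rnorm.
have fb z t : rnorm '[hincl (f z), adjoint Y t] <= rnorm z * (c * rnorm (adjoint Y t)).
  have [->|Yt0] := eqVneq (adjoint Y t) 0.
    by rewrite hdot0r !rnorm0 !mulr0.
  rewrite hXY (le_trans (cauchy_schwarz_rnorm _ _))// ler_wpM2l ?rnorm_ge0//.
  rewrite -ler_pdivrMr ?rnorm_gt0// mulrC.
  rewrite -[(rnorm _)^-1]rnorm_real ?invr_ge0 ?rnorm_ge0// -rnormZ.
  by apply: cS; exists t.
pose F : {linear H -> hsubspace M} := HB.pack f (GRing.isLinear.Build _ _ _ _ f fl).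
have Fc : continuous f.
  (* Choose [Y^* t] within [|f z| / 2] of [f z], so that [|Y^* t| <= 3/2 |f z|]. Splitting [f z] in
     one factor of ['[f z, f z]] gives [|f z|^2 <= 3/2 c |z| |f z| + |f z|^2 / 2], hence the
     constant [3 * c]. *)
  apply: (bounded_continuous F (3 * c)) => z /=.
  have [->|fz0] := eqVneq (f z) 0.
    rewrite rnorm0 !mulr_ge0 ?rnorm_ge0//.
    by apply: le_trans (cS _ _); [exact: rnorm_ge0|exists 0].
  have nf0 : 0 < rnorm (f z) by rewrite rnorm_gt0.
  have nf2 : 0 < rnorm (f z) / 2 by rewrite divr_gt0.
  have nf2' : 0 < (rnorm (f z) / 2)%:C by rewrite ltcR.
  have [_ [[t _ <-]]] := hinclP (f z) _ (nbhsx_ballx (hincl (f z)) _ nf2').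
  rewrite -ball_normE/= rnormE ltcR => fzt.
  have : rnorm (f z) ^+ 2 <=
      rnorm z * (c * rnorm (adjoint Y t)) + rnorm (f z) * (rnorm (f z) / 2).
    rewrite -(rnorm_real _ (sqr_ge0 _)) -hdot_rnorm -hdot_hincl.
    rewrite -{2}[hincl (f z)](subrK (adjoint Y t)) addrC hdotDr.
    rewrite (le_trans (rnormD _ _))// lerD//.
    rewrite (le_trans (cauchy_schwarz_rnorm _ _))// ler_pM2l//; exact: ltW.
  have := rnormD (adjoint Y t - hincl (f z)) (hincl (f z)); rewrite subrK.
  rewrite (rdistC (adjoint Y t)) -[rnorm (hincl _)]/(rnorm (f z)) => Yt h.
  have c0 : 0 <= c by apply: le_trans (cS _ _); [exact: rnorm_ge0|exists 0].
  have zc : rnorm z * (c * rnorm (adjoint Y t)) <= rnorm z * (c * (3 / 2 * rnorm (f z))).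
    rewrite ler_wpM2l ?rnorm_ge0// ler_wpM2l//.
    by lra.
  have : rnorm (f z) ^+ 2 <= 3 * c * rnorm z * rnorm (f z) by nra.
  by rewrite expr2 ler_pM2r.
exists (hincl \o bounded_op fl Fc) => z /=.
by rewrite fP.
Qed.

End RangeInclusion.

(** With [D] from the factorization of [A^n] through [A^*], the positive operator is [P = D D^*]. *)
Lemma n_power_posinormal_range {R : realType} {H : hilbertType R}
    (A : {bounded H -> H}) n :
  range (iter n A) `<=` range (adjoint A) -> n_power_posinormal n A.
Proof.
move=> /(range_factorization (iter n A) (adjoint A))[D AD].
exists (D \o adjoint D) => [x|x] /=.
  by rewrite adjointP hdot_norm exprn_ge0.
rewrite AD; congr (adjoint A (D _)); apply: hdot_inj => z.
by rewrite -iter_adjointP AD adjointPr adjointP.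
Qed.

(** * Upper triangular operators and nilpotent corners *)

Lemma nilpotent_resolvent {R : realType} {H : hilbertType R}
    (C : {bounded H -> H}) k (a : R[i]) :
  a != 0 -> (forall v, iter k C v = 0) ->
  exists S : {bounded H -> H},
    (forall x, S (C x - a *: x) = x) /\ (forall x, C (S x) - a *: S x = x).
Proof.
move=> a0 Ck.
(* [S] is the finite Neumann sum of the terms [- a^-(j+1) C^j] for [j < k], built by the recursion
   [S' = a^-1 (C S - 1)]. Commuting with [C] makes it a two-sided inverse once [C^k = 0]. *)
have [S [CS SE]] : exists S : {bounded H -> H},
    (forall x, C (S x) = S (C x)) /\
    (forall x, S (C x - a *: x) = x - a ^- k *: iter k C x).
  elim: k {Ck} => [|k [S [CS SE]]].
    have [S S0] := ex_bounded_lincomb 0 0 (@idfun H) (@idfun H).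
    have {}S0 x : S x = 0 by rewrite S0 !scale0r addr0.
    by exists S; split=> x; rewrite !S0 ?bounded0// expr0 invr1 scale1r subrr.
  have [S' S'E] := ex_bounded_lincomb a^-1 (- a^-1) (C \o S) (@idfun H).
  have {}S'E x : S' x = a^-1 *: (C (S x) - x).
    by rewrite S'E /= scaleNr scalerBr.
  exists S'; split=> x; rewrite !S'E.
    by rewrite boundedZ boundedB CS.
  rewrite SE (boundedB C) (boundedZ C) opprB addrC addrA subrK.
  by rewrite scalerBr !scalerA mulVf// scale1r exprS invfM.
exists S; split=> x.
  by rewrite SE Ck scaler0 subr0.
have -> : C (S x) - a *: S x = S (C x - a *: x).
  by rewrite (boundedB S) (boundedZ S) CS.
by rewrite SE Ck scaler0 subr0.
Qed.

Section UpperTriangular.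
Context {R : realType} {H : hilbertType R} {T : {bounded H -> H}}.
Context {M N : closedSubspace H}.
Hypothesis MN : orthogonal_decomposition M N.
Hypothesis TM : forall x, csub_set M x -> csub_set M (T x).

Let P : {bounded H -> hsubspace M} := hproj.
Let Q : {bounded H -> hsubspace N} := hproj.
Let A : {bounded hsubspace M -> hsubspace M} := P \o (T \o hincl).
Let B : {bounded hsubspace N -> hsubspace M} := P \o (T \o hincl).
Let C : {bounded hsubspace N -> hsubspace N} := Q \o (T \o hincl).

Lemma proj_orthoM x : csub_set M x -> Q x = 0.
Proof.
by move=> Mx; apply: hproj_eq0 => w Nw; exact/hdot_eq0_sym/(MN.1 _ _ Mx Nw).
Qed.

Lemma proj_orthoN x : csub_set N x -> P x = 0.
Proof. by move=> Nx; apply: hproj_eq0 => w Mw; exact: (MN.1 _ _ Mw Nx). Qed.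

Lemma proj_decomp z : z = hincl (P z) + hincl (Q z).
Proof.
have [x [y [/hincl_ex[u <-] /hincl_ex[v <-] ->]]] := MN.2 z.
rewrite !boundedD/= (proj_orthoM _ (hinclP u)) (proj_orthoN _ (hinclP v)).
by rewrite /P /Q !hprojK addr0 add0r.
Qed.

Lemma hincl_diag u : hincl (A u) = T (hincl u).
Proof.
have /hincl_ex[w Tw] := TM _ (hinclP u).
by rewrite /A/= -Tw /P hprojK.
Qed.

(** [Q] kills [T] applied to the [M]-component, since [M] is invariant. *)
Lemma proj_compression z : Q (T z) = C (Q z).
Proof.
rewrite {1}(proj_decomp z) !boundedD -hincl_diag.
by rewrite (proj_orthoM _ (hinclP _)) add0r.
Qed.

Lemma proj_iter_compression n z : Q (iter n T z) = iter n C (Q z).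
Proof. by elim: n => //= n <-; rewrite proj_compression. Qed.

Lemma has_upper_triangular_form : has_matrix_form T A B (fun=> 0) C.
Proof.
move=> u v; rewrite -!/(hincl _) add0r boundedD -hincl_diag.
by rewrite [T (hincl v)]proj_decomp addrA (boundedD hincl).
Qed.

Lemma spectrum_nilpotent_corner k (a : R[i]) : a != 0 ->
  (forall v, iter k C v = 0) -> spectrum T a <-> spectrum A a.
Proof.
move=> a0 Ck; have [S [SC CS]] := nilpotent_resolvent C k a a0 Ck.
split; apply: contra_not => -[V [VT TV]].
  (* With [V] inverse to [A - a], the operator [Z] below is the block inverse of [T - a], with rows
     [V, - V B S] and [0, S]. *)
  have [W WE] := ex_bounded_lincomb 1 (-1) P (B \o (S \o Q)).
  have [Z ZE] := ex_bounded_lincomb 1 1 (hincl \o (V \o W)) (hincl \o (S \o Q)).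
  have ZE' x : Z x = hincl (V (P x - B (S (Q x)))) + hincl (S (Q x)).
    by rewrite ZE /= WE !scale1r scaleN1r.
  have PT x : P (T x) = A (P x) + B (Q x).
    by rewrite {1}[x]proj_decomp !boundedD.
  exists Z; split=> x.
    have QTx : Q (T x - a *: x) = C (Q x) - a *: Q x.
      by rewrite boundedB boundedZ proj_compression.
    have PTx : P (T x - a *: x) = A (P x) - a *: P x + B (Q x).
      by rewrite boundedB boundedZ PT addrAC.
    by rewrite ZE' QTx SC PTx addrK VT -proj_decomp.
  have PZ : P (Z x) = V (P x - B (S (Q x))).
    by rewrite ZE' boundedD (proj_orthoN _ (hinclP _)) addr0 /P hprojK.
  have QZ : Q (Z x) = S (Q x).
    by rewrite ZE' boundedD (proj_orthoM _ (hinclP _)) add0r /Q hprojK.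
  rewrite [LHS]proj_decomp [RHS]proj_decomp.
  rewrite (boundedB P) (boundedZ P) (boundedB Q) (boundedZ Q).
  rewrite proj_compression QZ CS; congr (hincl _ + _).
  by rewrite PT PZ QZ addrAC TV subrK.
have inclA u : hincl (A u - a *: u) = T (hincl u) - a *: hincl u.
  by rewrite boundedB boundedZ -hincl_diag.
exists (P \o (V \o hincl)); split=> u.
  by rewrite /= inclA VT /P hprojK.
(* The inverse [V] of [T - a] preserves [M]: [C - a] sends [Q V u] to [Q u = 0], and it is
   injective. Thus [V] restricts to an inverse of [A - a]. *)
have QV : Q (V (hincl u)) = 0.
  rewrite -[LHS]SC -proj_compression -boundedZ -boundedB TV.
  by rewrite (proj_orthoM _ (hinclP _)) bounded0.
have PV : hincl (P (V (hincl u))) = V (hincl u).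
  by rewrite {2}[V _]proj_decomp QV bounded0 addr0.
rewrite -[LHS]/(A (P (V (hincl u))) - a *: P (V (hincl u))).
by rewrite -[LHS]hprojK inclA PV TV hprojK.
Qed.

End UpperTriangular.

(** * The closure of the range of [T^k] and the compression to it *)

Section RangeOfPower.
Context {R : realType} {H : hilbertType R} (T : {bounded H -> H}) (k : nat).
Let M := op_closure_range (iter k T).
Let N := op_kernel (iter k (adjoint T)).

(** [N] is the orthogonal complement of [M]; the components of [z] are its projection onto [M] and
    the remainder. *)
Lemma range_kernel_decomposition : orthogonal_decomposition M N.
Proof.
split=> [x y Mx Ny|z].
  apply: (orth_closure (range (iter k T))) => // _ [t _ <-].
  by rewrite iter_adjointP Ny hdot0r.
exists (hincl (hproj z : hsubspace M)), (z - hincl (hproj z : hsubspace M)).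
split; [exact: hinclP| |by rewrite addrC subrK].
apply: hdot_inj => t /=; rewrite -iter_adjointP hdot0r; apply: hproj_orth.
by apply: subset_closure; exists t.
Qed.

(** [T] commutes with [T^k] and is continuous. *)
Lemma closure_range_invariant x : csub_set M x -> csub_set M (T x).
Proof.
move=> Mx B TB; have : nbhs x (T @^-1` B) by exact: (@cts_fun _ _ T x B TB).
move=> /Mx[_ [[t _ <-] BTt]]; exists (iter k T (T t)).
by split; [exists (T t) => //; rewrite -iterSr|rewrite -iterSr].
Qed.

Lemma compression_range n : k_quasi_n_power_posinormal k n T ->
  forall A : {bounded hsubspace M -> hsubspace M},
  (forall u, hincl (A u) = T (hincl u)) -> range (iter n A) `<=` range (adjoint A).
Proof.
move=> Tkn A AT _ [u _ <-].
have [|w _ wE] := Tkn (iter k (adjoint T) (iter n T (hincl u))).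
  by exists (hincl u).
have hA m v : hincl (iter m A v) = iter m T (hincl v).
  by elim: m => //= m <-; rewrite AT.
have Nw : csub_set N (iter n T (hincl u) - adjoint T w).
  by rewrite /= (boundedB (iter k (adjoint T))) /= -wE iterSr subrr.
exists (hproj w) => //; apply: hdot_inj => z.
rewrite -adjointP -hprojP AT adjointP -[RHS]hdot_hincl hA.
apply/eqP; rewrite eq_sym -subr_eq0 -hdotBr; apply/eqP.
exact: (range_kernel_decomposition.1 _ _ (hinclP _) Nw).
Qed.

End RangeOfPower.

Theorem theorem2p13 (R : realType) (H : hilbertType R) (k n : nat)
    (T : {bounded H -> H}) :
  (0 < k)%N -> (0 < n)%N ->
  k_quasi_n_power_posinormal k n T ->
  ~ dense (range (iter k T)) ->
  let M := op_closure_range (iter k T) in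
  let N := op_kernel (iter k (adjoint T)) in
  orthogonal_decomposition M N /\
  exists (A : {bounded hsubspace M -> hsubspace M})
         (B : {bounded hsubspace N -> hsubspace M})
         (C : {bounded hsubspace N -> hsubspace N}),
    [/\ has_matrix_form T A B (fun=> 0) C,
        n_power_posinormal n A,
        (forall v, iter k C v = 0) &
        spectrum T = spectrum A `|` [set 0]].
Proof.
move=> _ _ Tkn Tk_dense M N.
have MN : orthogonal_decomposition M N := range_kernel_decomposition T k.
have TM : forall x, csub_set M x -> csub_set M (T x) := closure_range_invariant T k.
split=> //.
exists (hproj \o (T \o hincl)), (hproj \o (T \o hincl)), (hproj \o (T \o hincl)).
(* [C^k v] is the projection onto [N] of [T^k v], which lies in [M]. *)
have Ck (v : hsubspace N) : iter k (hproj \o (T \o hincl)) v = 0.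
  rewrite -[v]hprojK -(proj_iter_compression MN TM).
  by apply: (proj_orthoM MN); apply: subset_closure; exists (hincl v).
split=> //; first exact: has_upper_triangular_form MN TM.
  apply: n_power_posinormal_range.
  by apply: compression_range Tkn _ _; exact: hincl_diag TM.
(* If [S] inverted [T], then [T^k (S^k x) = x] would make the range of [T^k] all of [H], hence
   dense. *)
have T0 : spectrum T 0.
  move=> [S [_ TS]]; apply: Tk_dense.
  have Titer m x : iter m T (iter m S x) = x.
    by elim: m x => // m IH x; rewrite iterSr iterS -[T _]subr0
      -(scale0r (S (iter m S x))) TS IH.
  move=> U [x Ux] _; exists x; split=> //.
  by exists (iter k S x).
apply/seteqP; split=> [a Ta|a [Aa|->//]].
  have [->|a0] := eqVneq a 0; [by right|left].
  exact/(spectrum_nilpotent_corner MN TM k a a0 Ck).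
have [->//|a0] := eqVneq a 0.
exact/(spectrum_nilpotent_corner MN TM k a a0 Ck).
Qed.
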